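(* Let $p$ be a prime number and let $n$ be a positive integer. For the $n$-fold product $\mathbb{Z}_p^n$ of the cyclic group $\mathbb{Z}_p$ of order $p$, $$r_1(\mathbb{Z}_p^n)=\frac{p^{2n-1}+p^{n+1}-p^{n-1}+p^2-p-1}{p^2-1}.$$
   Context: For a finite group $G$, let $G(1)=\{(g,k)\in G\times G : [k,g]=1\}$ be the set of commuting pairs. Consider the graph with vertex set $G(1)$ whose edges are given by the identifications $(g,k)\sim(g,kg^m)$ for $m\in\mathbb{Z}$, and $(g,k)\sim(gkg^{-1},g^{-1})=(k,g^{-1})$. The number $r_1(G)$ is the number of connected components of this graph. *)

(* Defs.v *)
From HB Require Import structures.
From mathcomp Require Import all_boot all_order all_algebra all_fingroup.
From mathcomp Require Import boolp.

Set Implicit Arguments.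
Unset Strict Implicit.
Unset Printing Implicit Defensive.

Local Open Scope group_scope.

Section CommutingPairs.

Variable gT : finGroupType.
Implicit Types (x g k : gT) (u v : gT * gT) (G : {group gT}).

(* mathcomp provides x ^+ n for n : nat only; recall Negz n = - n.+1 *)
Definition expgz x (m : int) : gT :=
  match m with Posz n => x ^+ n | Negz n => x ^- n.+1 end.

Definition commuting_pairs G : {set gT * gT} :=
  [set u in setX G G | [~ u.2, u.1] == 1].

Inductive identification : gT * gT -> gT * gT -> Prop :=
| IdTwist g k (m : int) : identification (g, k) (g, k * expgz g m)
| IdSwap g k : identification (g, k) (g * k * g^-1, g^-1).

(* The graph is undirected, and its vertex set is commuting_pairs G rather
   than all of gT * gT. *)
Definition adjacent G : rel (gT * gT) := fun u v =>
  [&& u \in commuting_pairs G, v \in commuting_pairs G &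
      `[< identification u v \/ identification v u >]].

Definition r1 G : nat := n_comp (adjacent G) (commuting_pairs G).

(* n_comp counts connected components only under the next two properties. *)
Lemma adjacent_connect_sym G : connect_sym (adjacent G).
Proof.
apply: sym_connect_sym => u v; rewrite /adjacent.
suff -> : `[< identification u v \/ identification v u >]
        = `[< identification v u \/ identification u v >] by rewrite andbCA.
by apply/asboolP/asboolP => -[]; [right | left | right | left].
Qed.

Lemma closed_adjacent G : closed (adjacent G) (commuting_pairs G).
Proof. by move=> u v /and3P[-> ->]. Qed.

Lemma identification_commuting G u v :
  u \in commuting_pairs G -> identification u v -> v \in commuting_pairs G.
Proof.
move=> uG uv; case: uv uG => g k => [m|]; rewrite !inE /= -andbA.
- case/and3P=> gG kG /commgP kg.
  have xG : expgz g m \in G by case: m => n /=; rewrite ?groupV groupX.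
  rewrite gG groupM //=; apply/commgP; apply: commute_sym.
  apply: commuteM; first exact: commute_sym.
  by case: m {xG} => n /=; [|apply: commuteV]; apply: commuteX.
- case/and3P=> gG kG /commgP kg.
  rewrite !groupM ?groupV //= -(kg) mulgK.
  by rewrite gG; apply/commgP; apply/commute_sym/commuteV.
Qed.

End CommutingPairs.

(* Main.v *)
(* On (F_p^n)^2 the two identifications are the elementary matrices (1 0; m 1)
   and (0 1; -1 0), which generate SL_2(F_p); so r_1 is the number of orbits of
   SL_2(F_p), that is, the sum over all pairs of 1 / (size of the orbit).  The
   zero pair is fixed, the orbit of a nonzero dependent pair (a v, b v) consists
   of the p^2 - 1 pairs (a' v, b' v) with (a', b') nonzero, and the action is
   free on independent pairs, where orbits have |SL_2(F_p)| = p (p^2 - 1)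
   elements. *)

Require Import Defs.
From HB Require Import structures.
From mathcomp Require Import all_boot all_order all_algebra all_fingroup.
From mathcomp Require Import boolp ring zify.
Import GRing.Theory.
Local Open Scope ring_scope.

(** A component with c elements contributes c terms 1/c, hence 1; the sum is grouped by the root
    that represents each component. *)
Lemma n_comp_sum_inv (T : finType) (e : rel T) (A : {set T}) :
  connect_sym e -> closed e A ->
  (n_comp e A)%:R = \sum_(x in A) (#|connect e x|%:R)^-1 :> rat.
Proof.
move=> eC clA.
rewrite (partition_big (fingraph.root e) [predI roots e & A]) /=; last first.
  move=> x xA; rewrite !inE roots_root //=.
  by rewrite -(closed_connect clA (connect_root e x)).
rewrite /n_comp_mem -sum1_card natr_sum.
apply: eq_big => [r|r]; rewrite !inE //.
case/andP=> /eqP rr rA.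
(* As [A] is closed, the fibre over the root [r] is the whole component of [r]. *)
rewrite (eq_bigl (connect e r)) => [|x]; last first.
  rewrite -{1}rr eq_sym root_connect //; case: (boolP (connect e r x)) => rx.
    by rewrite -(closed_connect clA rx) rA.
  by rewrite andbF.
rewrite (eq_bigr (fun=> (#|connect e r|%:R)^-1)) => [|x rx]; last first.
  by congr (_%:R^-1); apply: eq_card => y; rewrite !inE (same_connect eC rx).
rewrite sumr_const -[RHS]mulr_natl mulfV // Num.Theory.pnatr_eq0 -lt0n.
by apply/card_gt0P; exists r; apply: connect0.
Qed.

(** * The action of SL_2 over a finite field on pairs of vectors *)

Section SL2.

Variables (F : finFieldType) (V : finLmodType F).
Implicit Types (u : V * V) (v g k : V) (x y : F * F) (m : (F * F) * (F * F)).

(* ((a, b), (c, d)) is the matrix with rows (a, b) and (c, d). *)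
Definition SL2 : {set (F * F) * (F * F)} :=
  [set m | m.1.1 * m.2.2 - m.1.2 * m.2.1 == 1].

Lemma SL2_lower (t : F) : ((1, 0), (t, 1)) \in SL2.
Proof. by rewrite inE /= mul1r mul0r subr0. Qed.

Definition sl2_act m u : V * V :=
  (m.1.1 *: u.1 + m.1.2 *: u.2, m.2.1 *: u.1 + m.2.2 *: u.2).

Definition sl2_orbit u : {set V * V} := [set sl2_act m u | m in SL2].

Definition dependent u : bool :=
  [exists x : F * F, (x != 0) && (x.1 *: u.1 + x.2 *: u.2 == 0)].

Lemma pair_neq0 x : (x != 0) = (x.1 != 0) || (x.2 != 0).
Proof. by rewrite -negb_and; case: x. Qed.

Lemma scaler_injr v : v != 0 -> injective (fun a : F => a *: v).
Proof.
move=> v0 a b /eqP; rewrite -subr_eq0 -scalerBl scaler_eq0 (negPf v0) orbF.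
by rewrite subr_eq0 => /eqP.
Qed.

Lemma sl2_orbit_act {u w m} :
  m \in SL2 -> w \in sl2_orbit u -> sl2_act m w \in sl2_orbit u.
Proof.
move=> mS /imsetP[m' m'S ->].
case: m m' mS m'S => [[a b] [c d]] [[a' b'] [c' d']].
rewrite !inE /= => /eqP D /eqP D'.
(* The witness is the matrix product of [m] and [m']; its determinant is the product of the two
   determinants. *)
apply/imsetP; exists ((a * a' + b * c', a * b' + b * d'),
                      (c * a' + d * c', c * b' + d * d')).
  rewrite inE /=; apply/eqP.
  by rewrite -[RHS]mulr1 -{1}D -D'; ring.
rewrite /sl2_act /=; congr (_, _);
  by rewrite !scalerDr !scalerDl !scalerA addrACA.
Qed.

(** A matrix with upper right entry b != 0 factors as (1 0; z 1) (1 b; 0 1) (1 0; y 1) with y = (a -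
    1) / b and z = (d - 1) / b; the case b = 0 reduces to this one by a swap. *)
Lemma SL2_generated (R : rel (V * V)) :
    reflexive R -> symmetric R -> transitive R ->
    (forall g k (t : F), R (g, k) (g, k + t *: g)) ->
    (forall g k, R (g, k) (k, - g)) ->
  forall u w, w \in sl2_orbit u -> R u w.
Proof.
move=> Rr Rs Rt lower swap.
(* An upper transvection is a lower one with parameter [- t], conjugated by the swap. *)
have upper g k t : R (g, k) (g + t *: k, k).
  apply: (Rt (k, - g)) => //; apply: (Rt (k, - (g + t *: k))).
    by rewrite opprD -scaleNr.
  by rewrite Rs.
have R_act (a b c d : F) : a * d - b * c = 1 -> b != 0 ->
    forall g k, R (g, k) (sl2_act ((a, b), (c, d)) (g, k)).
  move=> D b0 g k; rewrite /sl2_act /=.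
  set y := (a - 1) / b; set z := (d - 1) / b.
  have aE : a = 1 + b * y by rewrite /y; field.
  have dE : d = z * b + 1 by rewrite /z; field.
  have cE : c = z + d * y.
    apply: (mulfI b0); have -> : b * c = a * d - 1 by rewrite -D; ring.
    by rewrite dE aE; ring.
  apply: (Rt _ _ _ (lower g k y)); apply: (Rt _ _ _ (upper _ _ b)).
  have := lower (g + b *: (k + y *: g)) (k + y *: g) z.
  congr (R _ (_, _)).
    by rewrite aE scalerDr scalerDl scale1r scalerA addrAC addrA.
  set w := k + y *: g; rewrite scalerDr scalerA addrCA -{1}[w]scale1r -scalerDl.
  by rewrite (addrC 1) -dE scalerDr scalerA cE scalerDl -addrA [d *: k + _]addrC.
move=> [g k] w /imsetP[[[a b] [c d]]]; rewrite inE /= => /eqP D ->.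
have [b0|/R_act] := eqVneq b 0; last exact.
have d0 : d != 0.
  by apply: contra_eqN D => /eqP->; rewrite b0 mulr0 mul0r subr0 eq_sym oner_eq0.
(* Following the matrix by the swap gives the rows (c, d) and (-a, -b), whose upper right entry d is
   nonzero. *)
have D' : c * (- b) - d * (- a) = 1 by rewrite -D; ring.
apply: Rt (R_act _ _ _ _ D' d0 g k) _.
by rewrite Rs /sl2_act /= !scaleNr -opprD.
Qed.

(** For a fixed nonzero row [x], the determinant condition is a nontrivial affine equation in two
    unknowns, so its solutions form a line. The line is parametrized by the second coordinate if the
    first entry of [x] is 0, and by the first coordinate otherwise. *)
Lemma card_unimodular_completion x :
  x != 0 -> #|[set y : F * F | x.1 * y.2 - x.2 * y.1 == 1]| = #|F|.
Proof.
rewrite pair_neq0; case: x => a b /=; rewrite -[in RHS]cardsT.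
have [-> /= b0|a0 _] := eqVneq a 0.
  rewrite -(card_imset (f := fun d => (- b^-1, d)) [set: F]) => [|d d' []//].
  apply: eq_card => -[c d]; rewrite inE /= mul0r sub0r.
  apply/eqP/imsetP => [D|[d' _ [-> _]]]; last by field.
  exists d => //; congr (_, _); apply: (mulfI b0).
  by rewrite mulrN divff // -D opprK.
rewrite -(card_imset (f := fun c => (c, (1 + b * c) / a)) [set: F])
  => [|c c' []//].
apply: eq_card => -[c d]; rewrite inE /=.
apply/eqP/imsetP => [D|[c' _ [-> ->]]]; last by field.
exists c => //; congr (_, _); apply: (mulfI a0).
by rewrite -D; field.
Qed.

Lemma unimodular_completion x : x != 0 -> exists y, x.1 * y.2 - x.2 * y.1 = 1.
Proof.
move/card_unimodular_completion => cardF.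
set S := [set _ | _] in cardF.
have /card_gt0P[y] : (0 < #|S|)%N by rewrite cardF; apply/card_gt0P; exists 0.
by rewrite inE => /eqP; exists y.
Qed.

(** Matrices are counted by their first row: the zero row has no completion, and every other row has
    [#|F|] of them. *)
Lemma card_SL2 : #|SL2| = (#|F| * (#|F| ^ 2 - 1))%N.
Proof.
rewrite -sum1_card (partition_big fst predT) //=.
rewrite (bigD1 (0 : F * F)) //= big1 ?add0n => [|[x y]]; last first.
  case/andP; rewrite inE /= => /eqP D /eqP x0; move/eqP: D.
  by rewrite x0 !mul0r subr0 eq_sym oner_eq0.
transitivity (\sum_(x : F * F | x != 0%R) #|F|)%N.
  apply: eq_bigr => x /card_unimodular_completion <-.
  rewrite -sum1_card [RHS](reindex_onto snd (pair x)) /=; last by case.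
  apply: eq_bigl => -[x' y]; rewrite !inE /= xpair_eqE eqxx andbT [x == _]eq_sym.
  by case: (x' =P x) => [->|]; rewrite ?andbT ?andbF.
rewrite sum_nat_const mulnC; congr (_ * _)%N.
by rewrite cardC1 card_prod mulnn subn1.
Qed.

(** Coefficients with respect to an independent pair are unique, so the image of [u] determines both
    rows of the matrix. *)
Lemma card_sl2_orbit_independent u : ~~ dependent u -> #|sl2_orbit u| = #|SL2|.
Proof.
move=> ind; have eq0 x : x.1 *: u.1 + x.2 *: u.2 = 0 -> x = 0.
  move=> xu; apply: contraNeq ind => x0; apply/existsP; exists x.
  by rewrite x0 xu eqxx.
have inj x y : x.1 *: u.1 + x.2 *: u.2 = y.1 *: u.1 + y.2 *: u.2 -> x = y.
  move=> /eqP; rewrite -subr_eq0 opprD addrACA -!scalerBl => /eqP/(eq0 (x - y)).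
  by move/eqP; rewrite subr_eq0 => /eqP.
by apply: card_imset => -[x y] [x' y'] [/inj-> /inj->].
Qed.

Lemma dependent_collinear u : u != 0 -> dependent u ->
  exists2 v, v != 0 & exists2 x, x != 0 & u = (x.1 *: v, x.2 *: v).
Proof.
case: u => g k /=; have [->|g0] := eqVneq g 0 => u0.
  move=> _; exists k; first by apply: contraNneq u0 => ->.
  exists (0, 1); first by rewrite pair_neq0 /= oner_eq0 orbT.
  by rewrite scale0r scale1r.
case/existsP=> -[a b] /= /andP[x0 /eqP D]; exists g => //.
exists (1, - (a / b)); first by rewrite pair_neq0 /= oner_eq0.
(* If b were 0, the relation would read a g = 0 with g != 0, forcing a = 0 as well. *)
have b0 : b != 0.
  apply: contraNneq x0 => b0; move/eqP: D.
  by rewrite b0 scale0r addr0 scaler_eq0 (negPf g0) orbF => /eqP->.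
rewrite scale1r; congr (_, _); apply: (can_inj (scalerK b0)).
rewrite scalerA mulrN mulrCA divff // mulr1 scaleNr.
by apply/eqP; rewrite -addr_eq0 addrC D.
Qed.

(** Writing u = (x.1 v, x.2 v), a matrix acts on the coefficient column [x] alone, and SL_2 is
    transitive on nonzero columns. *)
Lemma card_sl2_orbit_dependent u :
  u != 0 -> dependent u -> #|sl2_orbit u| = (#|F| ^ 2 - 1)%N.
Proof.
move=> u0 /(dependent_collinear _ u0)[v v0 [x x0 ->]].
transitivity #|[set y : F * F | y != 0]|; last first.
  by rewrite cardsE cardC1 card_prod mulnn subn1.
rewrite -(card_imset (f := fun y : F * F => (y.1 *: v, y.2 *: v))); last first.
  by move=> [a b] [a' b'] /= [/(scaler_injr _ v0)-> /(scaler_injr _ v0)->].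
have [z xz] := unimodular_completion _ x0.
apply: eq_card => w; apply/imsetP/imsetP => [[m mS ->]|[y]]; rewrite ?inE.
  exists (m.1.1 * x.1 + m.1.2 * x.2, m.2.1 * x.1 + m.2.2 * x.2); last first.
    by rewrite /sl2_act /= !scalerA -!scalerDl.
  rewrite inE; apply: contraNneq x0 => -[E1 E2]; move: mS; rewrite inE => /eqP D.
  (* The adjugate of [m], which is its inverse, applied to the zero column gives back [x]. *)
  have X1 : x.1 = m.2.2 * 0 - m.1.2 * 0.
    by rewrite -{1}E1 -E2 -[LHS]mul1r -D; ring.
  have X2 : x.2 = m.1.1 * 0 - m.2.1 * 0.
    by rewrite -{1}E2 -E1 -[LHS]mul1r -D; ring.
  by rewrite [x]surjective_pairing X1 X2 !mulr0 subr0.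
move=> y0 ->; have [t yt] := unimodular_completion _ y0.
(* the matrix (y | t) (x | z)^-1, with columns y, t and x, z *)
exists ((y.1 * z.2 - t.1 * x.2, t.1 * x.1 - y.1 * z.1),
        (y.2 * z.2 - t.2 * x.2, t.2 * x.1 - y.2 * z.1)).
  by rewrite inE /=; apply/eqP; rewrite -[RHS]mulr1 -{1}yt -xz; ring.
rewrite /sl2_act /= !scalerA -!scalerDl; congr (_ *: _, _ *: _).
  by rewrite -[LHS]mulr1 -xz; ring.
by rewrite -[LHS]mulr1 -xz; ring.
Qed.

(** Pairs are counted by their first vector g: if g = 0 any second vector will do, otherwise exactly
    the [#|F|] multiples of g. *)
Lemma card_dependent :
  #|[set u | dependent u]| = (#|V| + #|F| * (#|V| - 1))%N.
Proof.
transitivity (\sum_(g : V) #|[set k | dependent (g, k)]|)%N.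
  rewrite -sum1_card; under [RHS]eq_bigr do rewrite -sum1_card.
  rewrite pair_big_dep /=; by apply: eq_bigl => -[g k]; rewrite !inE.
rewrite (bigD1 0) //=; congr (_ + _)%N.
  rewrite -cardsT; apply: eq_card => k; rewrite !inE; apply/existsP.
  by exists (1, 0); rewrite pair_neq0 /= oner_eq0 scaler0 scale0r addr0 !eqxx.
rewrite mulnC subn1 -(cardC1 (0 : V)) -sum_nat_const; apply: eq_bigr => g g0.
rewrite -[RHS]cardsT -(card_imset [set: F] (scaler_injr _ g0)).
apply: eq_card => k; rewrite inE.
apply/idP/imsetP => [|[t _ ->]].
  move/dependent_collinear => []; first by apply: contraNneq g0 => -[->].
  move=> v v0 [x x0 [gE kE]]; exists (x.2 / x.1) => //.
  have x10 : x.1 != 0 by apply: contraNneq g0 => x10; rewrite gE x10 scale0r.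
  by rewrite gE scalerA divfK.
apply/existsP; exists (t, -1); rewrite pair_neq0 /= oppr_eq0 oner_eq0 orbT /=.
by rewrite scaleN1r subrr.
Qed.

Lemma card_sl2_orbit0 : #|sl2_orbit 0| = 1%N.
Proof.
rewrite -(cards1 (0 : V * V)); congr #|pred_of_set _|; apply/setP => w.
rewrite inE; apply/imsetP/eqP => [[m _ ->]|->].
  by rewrite /sl2_act /= !scaler0 !addr0.
exists ((1, 0), (0, 1)); first exact: SL2_lower.
by rewrite /sl2_act /= !scaler0 !addr0.
Qed.

(** The numerators (q + 1) (N - 1) and (N - 1) (N - q) are the numbers of nonzero dependent pairs
    and of independent pairs; the denominators are the orbit sizes. *)
Lemma sum_inv_card_sl2_orbit (q := #|F|%:R : rat) (N := #|V|%:R : rat) :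
  \sum_u (#|sl2_orbit u|%:R)^-1 =
    1 + (q + 1) * (N - 1) / (q ^+ 2 - 1)
      + (N - 1) * (N - q) / (q * (q ^+ 2 - 1)).
Proof.
have F_gt1 := card_finNzRing_gt1 F; have V_gt0 : (0 < #|V|)%N.
  by apply/card_gt0P; exists 0.
have q2E : (#|F| ^ 2 - 1)%:R = q ^+ 2 - 1 :> rat.
  by rewrite natrB ?natrX // expn_gt0 (ltnW F_gt1).
have dep0 : dependent 0.
  apply/existsP; exists (1, 0).
  by rewrite pair_neq0 /= oner_eq0 scale0r scaler0 addr0 !eqxx.
have depE : (#|[set u | dependent u]|)%:R = N + q * (N - 1).
  by rewrite card_dependent natrD natrM natrB.
have indE : (#|[set u | ~~ dependent u]|)%:R = N ^+ 2 - (N + q * (N - 1)).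
  rewrite -depE; apply/eqP; rewrite eq_sym subr_eq -natrD; apply/eqP.
  rewrite /N -natrX -mulnn -card_prod -(cardsC [set u | dependent u]) addnC.
  by congr (_ + _)%:R; apply: eq_card => u; rewrite !inE.
rewrite (bigID dependent) /= (bigD1 (0 : V * V)) //= card_sl2_orbit0 invr1.
rewrite (eq_bigr (fun=> (q ^+ 2 - 1)^-1)) => [|u /andP[du u0]]; last first.
  by rewrite card_sl2_orbit_dependent // q2E.
rewrite [X in _ + X](eq_bigr (fun=> (q * (q ^+ 2 - 1))^-1)) => [|u du];
    last first.
  by rewrite card_sl2_orbit_independent // card_SL2 natrM q2E.
rewrite !sumr_const -(mulr_natl (q ^+ 2 - 1)^-1) -(mulr_natl (q * _)^-1).
congr (_ + _ / _ + _ / _).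
  transitivity (N + q * (N - 1) - 1); last by ring.
  rewrite -depE (cardsD1 (0 : V * V)) inE dep0 natrD addrAC subrr add0r.
  by congr _%:R; apply: eq_card => u; rewrite !inE andbC.
transitivity (N ^+ 2 - (N + q * (N - 1))); last by ring.
by rewrite -indE; congr _%:R; apply: eq_card => u; rewrite !inE.
Qed.

End SL2.

(** This joins the module structure with finiteness, so that the section on SL_2 applies to
    [{ffun I -> W}]. *)
HB.instance Definition _ (R : finNzRingType) (I : finType) (W : finLmodType R) :=
  GRing.Lmodule.on {ffun I -> W}.

(** * Components of the graph of an elementary abelian group as SL_2 orbits *)

Section ElementaryAbelian.

Variables (p n : nat).
(** [gT] and [V] are two views of one type: the first carries the product group structure, the
    second the vector space structure over ['F_p]. *)
Local Notation gT := {dffun forall i : 'I_n, 'F_p}.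
Local Notation V := {ffun 'I_n -> ('F_p)^o}.
Local Notation G := [set: gT]%G.

Lemma expgz_scale (g : V) (z : int) : expgz (g : gT) z = z%:~R *: g.
Proof.
have nat_case k : ((g : gT) ^+ k)%g = k%:R *: g.
  elim: k => [|k IHk]; first by rewrite scale0r.
  by rewrite expgS IHk -natr1 addrC scalerDl scale1r;
    apply/ffunP => i; rewrite !ffunE.
by case: z => k; rewrite /= nat_case // NegzE mulrNz scaleNr;
  apply/ffunP => i; rewrite !ffunE.
Qed.

Lemma commuting_pairs_setT : commuting_pairs G = setT.
Proof.
apply/setP => -[g k]; rewrite !inE /=; apply/commgP.
by apply/ffunP => i; rewrite !ffunE; apply: addrC.
Qed.

Lemma identificationE (u w : V * V) :
  identification (u : gT * gT) w <->
  (exists t, w = (u.1, u.2 + t *: u.1)) \/ w = (u.2, - u.1).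
Proof.
have swapE (g k : V) : ((g : gT) * k * g^-1, g^-1)%g = (k, - g).
  congr (_, _); apply/ffunP => i; rewrite !ffunE.
  by rewrite /mulg /= /invg /= addrAC subrr add0r.
split=> [[g k z|g k]|]; first by left; exists z%:~R; rewrite expgz_scale.
  by right; rewrite swapE.
case: u => g k /= [[t]|] ->; last by rewrite -swapE; apply: IdSwap.
(* Every scalar [t] is the residue of its natural representative, which serves as the integer
   exponent. *)
have := IdTwist (g : gT) (k : gT) (t : nat); rewrite expgz_scale.
by rewrite -pmulrn natr_Zp.
Qed.

Lemma adjacentE (u w : V * V) :
  adjacent G u w = `[< identification (u : gT * gT) w \/
                       identification (w : gT * gT) u >].
Proof. by rewrite /adjacent commuting_pairs_setT !inE. Qed.

Lemma connect_adjacent (u w : V * V) :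
  connect (adjacent G) u w = (w \in sl2_orbit _ _ u).
Proof.
have eC := adjacent_connect_sym G.
apply/idP/idP => [uw|]; last first.
  apply: (SL2_generated _ _ (fun u w : V * V => connect (adjacent G) u w)).
  - exact: connect0.
  - exact: eC.
  - exact: connect_trans.
  - move=> g k t; apply: connect1; rewrite adjacentE; apply/asboolP; left.
    by apply/identificationE; left; exists t.
  - move=> g k; apply: connect1; rewrite adjacentE; apply/asboolP; left.
    by apply/identificationE; right.
(* Edges are undirected, so four matrices are needed: those of the two identifications and their
   inverses. *)
have step (x y : V * V) :
    adjacent G x y -> x \in sl2_orbit _ _ u -> y \in sl2_orbit _ _ u.
  rewrite adjacentE => /asboolP xy xu.
  suff [m mS ->] : exists2 m, m \in SL2 'F_p & y = sl2_act _ _ m x.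
    exact: sl2_orbit_act.
  case: xy => /identificationE[[t]|].
  - move=> ->; exists ((1, 0), (t, 1)); first exact: SL2_lower.
    by rewrite /sl2_act /= scale0r addr0 !scale1r addrC.
  - move=> ->; exists ((0, 1), (-1, 0)).
      by rewrite inE /= mul0r sub0r mul1r opprK.
    by rewrite /sl2_act /= !scale0r add0r addr0 scale1r scaleN1r.
  - move=> ->; exists ((1, 0), (- t, 1)); first exact: SL2_lower.
    case: y {xu} => g k.
    by rewrite /sl2_act /= scale0r addr0 !scale1r scaleNr addrC addrK.
  - move=> ->; exists ((0, -1), (1, 0)).
      by rewrite inE /= mul0r sub0r mulr1 opprK.
    case: y {xu} => g k.
    by rewrite /sl2_act /= !scale0r add0r addr0 scale1r scaleN1r opprK.
(* The orbit of [u] is closed under adjacency, so it remains to see that it contains [u], by the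
   identity matrix. *)
rewrite -(closed_connect (intro_closed eC step) uw); apply/imsetP.
exists ((1, 0), (0, 1)).
  exact: SL2_lower.
by rewrite /sl2_act /= !scale0r !scale1r addr0 add0r -surjective_pairing.
Qed.

Lemma r1_elementary_abelian (q := #|'F_p|%:R : rat) (N := #|V|%:R : rat) :
  (r1 G)%:R = 1 + (q + 1) * (N - 1) / (q ^+ 2 - 1)
      + (N - 1) * (N - q) / (q * (q ^+ 2 - 1)).
Proof.
rewrite -sum_inv_card_sl2_orbit /r1 n_comp_sum_inv; first last.
- exact: closed_adjacent.
- exact: adjacent_connect_sym.
apply: eq_big => [u|u _]; first by rewrite commuting_pairs_setT inE.
by congr (_%:R^-1); apply: eq_card => w; apply: connect_adjacent.
Qed.

End ElementaryAbelian.

Theorem theorem8 (p n : nat) (p_prime : prime p) (n_gt0 : (0 < n)%N) :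
  (r1 [set: {dffun forall i : 'I_n, 'Z_p}]%G)%:R =
    (p%:R ^+ (2 * n - 1) + p%:R ^+ (n + 1) - p%:R ^+ (n - 1)
       + p%:R ^+ 2 - p%:R - 1) / (p%:R ^+ 2 - 1) :> rat.
Proof.
(* 'F_p is notation for 'Z_(pdiv p). *)
have -> : r1 [set: {dffun forall i : 'I_n, 'Z_p}]%G
        = r1 [set: {dffun forall i : 'I_n, 'F_p}]%G by rewrite pdiv_id.
rewrite r1_elementary_abelian card_ffun !card_ord Fp_cast // natrX.
have p0 : p%:R != 0 :> rat by rewrite Num.Theory.pnatr_eq0 -lt0n prime_gt0.
have p2 : p%:R ^+ 2 - 1 != 0 :> rat.
  rewrite subr_eq0 -natrX (_ : 1 = 1%:R) // Num.Theory.eqr_nat.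
  by rewrite (eqn_exp2r p 1 (isT : (0 < 2)%N)) neq_ltn prime_gt1 ?orbT.
(* With the exponent written as a successor, the truncated subtractions [2 * n - 1] and [n - 1]
   become exact. *)
case: n n_gt0 => // n _.
rewrite (_ : 2 * n.+1 - 1 = n + n + 1)%N; last lia.
rewrite addn1 subn1 /= !exprS !exprD.
by field; rewrite p0 andbT -expr2.
Qed.
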